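(* Let $\epsilon\in(0,1)$, let $M$ be a positive integer, $\delta=\epsilon/(ML)$, and let $H=[H_1,\dots,H_L]$ be an $m\times ML$ matrix with $L$ blocks $H_\ell\in\mathbb{R}^{m\times M}$ such that $\mathrm{Col}_j[H]\in\mathcal H_\delta$ for all $j\le ML$. Consider the optimization problem $$ \mathfrak p_+[H]=2\min_{\lambda_\ell,\mu^\ell,\upsilon^\ell,\rho}\left\{\rho:\ \begin{array}{l}\mu^\ell\ge0,\ \upsilon^\ell\ge0,\ \lambda_\ell+\phi_{\mathcal T}(\mu^\ell)+\sum_{j=1}^M\upsilon^\ell_j\le\rho,\ \ell\le L,\\[4pt] \begin{bmatrix}\lambda_\ell I_\nu&\tfrac12R_\ell^{1/2}B\\ \tfrac12B^TR_\ell^{1/2}&A^TH_\ell\,\mathrm{Diag}\{\upsilon^\ell\}H_\ell^TA+\sum_{k=1}^K\mu^\ell_kT_k\end{bmatrix}\succeq0,\ \ell\le L\end{array}\right\} $$ with variables $\lambda_\ell\in\mathbb{R}$, $\mu^\ell\in\mathbb{R}^K$, $\upsilon^\ell\in\mathbb{R}^M$ ($\ell\le L$), $\rho\in\mathbb{R}$. Then the polyhedral estimate $\widehat w^H$ with contrast matrix $H$ satisfies $$\mathrm{Risk}_\epsilon[\widehat w^H|\mathcal X]\le\mathfrak p_+[H].$$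
   Context: Notation: $\mathbf S^d_+$ is the cone of positive semidefinite symmetric $d\times d$ matrices, $\succeq$ the semidefinite order; $[M_1;\dots;M_q]$ is vertical concatenation; $\mathrm{Col}_j[H]$ is the $j$-th column of $H$; $\phi_{\mathcal T}(y)=\sup_{u\in\mathcal T}y^Tu$. Observation model: $\omega=A[\eta]x+\xi\in\mathbb{R}^m$ with $A[\eta]=A+\sum_{\alpha=1}^q\eta_\alpha A_\alpha$, where $A,A_1,\dots,A_q\in\mathbb{R}^{m\times n}$ are given. The unknown signal $x$ belongs to $\mathcal X\subset\mathbb R^n$, and one wants to recover $Bx$, $B\in\mathbb{R}^{\nu\times n}$ given. The random vectors $\xi$ and $\eta$ are zero-mean sub-Gaussian: $\mathbf E\{e^{t^T\xi}\}\le\exp(\tfrac{\sigma^2}{2}\|t\|_2^2)$ for all $t\in\mathbb{R}^m$ (with given $\sigma>0$) and $\mathbf E\{e^{t^T\eta}\}\le\exp(\tfrac12\|t\|_2^2)$ for all $t\in\mathbb{R}^q$. Error norm: $\|u\|=\max_{\ell\le L}\sqrt{u^TR_\ell u}$ on $\mathbb{R}^\nu$, where $R_\ell\in\mathbf S^\nu_+$, $\sum_\ell R_\ell\succ0$. Signal set (basic ellitope): $\mathcal X=\{x\in\mathbb{R}^n:\exists t\in\mathcal T:\ x^TT_kx\le t_k,\ k\le K\}$, where $T_k\in\mathbf S^n_+$, $\sum_kT_k\succ0$, and $\mathcal T\subset\mathbb{R}^K_+$ is a convex compact set with nonempty interior such that $0\le t'\le t\in\mathcal T$ implies $t'\in\mathcal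 T$. Set of admissible columns: for $\delta\in(0,1)$, $\chi(\delta)=2\sqrt{2\ln(2/\delta)}$; for $h\in\mathbb{R}^m$, $\mathcal A[h]=[h^TA_1;\dots;h^TA_q]\in\mathbb{R}^{q\times n}$, $\|\mathcal A[h]\|_{\mathcal X,2}=\max_{x\in\mathcal X}\|\mathcal A[h]x\|_2$; and $$\mathcal H_\delta=\{h\in\mathbb{R}^m:\ \|h\|_2\le[\sigma\chi(\delta)]^{-1},\ \|\mathcal A[h]\|_{\mathcal X,2}\le\chi^{-1}(\delta)\}.$$ Polyhedral estimate with contrast matrix $H$: $\widehat x^H(\omega)\in\mathrm{Argmin}_{u\in\mathcal X}\|H^T[Au-\omega]\|_\infty$, $\widehat w^H(\omega)=B\widehat x^H(\omega)$. $\epsilon$-risk: $\mathrm{Risk}_\epsilon[\widehat w|\mathcal X]=\sup_{x\in\mathcal X}\inf\{\rho:\ \mathrm{Prob}_{\xi,\eta}\{\|Bx-\widehat w(A[\eta]x+\xi)\|>\rho\}\le\epsilon\}$. *)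

(* Defs.v *)
From HB Require Import structures.
From mathcomp Require Import all_boot all_order all_algebra.
From mathcomp Require Import all_classical all_reals all_analysis.

Set Implicit Arguments.
Unset Strict Implicit.
Unset Printing Implicit Defensive.

Import Order.TTheory GRing.Theory Num.Theory.
Import numFieldNormedType.Exports.

Local Open Scope classical_set_scope.
Local Open Scope ring_scope.

Section LinearAlgebra.
Context {R : realType}.

Definition dotv n (u v : 'cV[R]_n) : R := (u^T *m v) ord0 ord0.

Definition quadform n (Q : 'M[R]_n) (x : 'cV[R]_n) : R :=
  (x^T *m Q *m x) ord0 ord0.

(* The library norm `|x| on matrices is the entrywise maximum, i.e. the
   infinity norm on column vectors; the Euclidean norm is needed as well. *)
Definition l2norm n (x : 'cV[R]_n) : R := Num.sqrt (dotv x x).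

Definition psdmx n (Q : 'M[R]_n) : Prop :=
  Q^T = Q /\ forall x : 'cV[R]_n, 0 <= quadform Q x.

Definition pdmx n (Q : 'M[R]_n) : Prop :=
  Q^T = Q /\ forall x : 'cV[R]_n, x != 0 -> 0 < quadform Q x.

(* Q^{1/2}: the (unique) positive semidefinite S with S S = Q when Q is
   positive semidefinite; 0 if there is no such S. *)
Definition sqrtmx n (Q : 'M[R]_n) : 'M[R]_n :=
  xget 0 [set S : 'M[R]_n | psdmx S /\ S *m S = Q].

Definition nonnegv n (u : 'cV[R]_n) : Prop := forall i, 0 <= u i ord0.

Definition lev n (u v : 'cV[R]_n) : Prop := forall i, u i ord0 <= v i ord0.

Definition support_fun n (T : set 'cV[R]_n) (y : 'cV[R]_n) : \bar R :=
  ereal_sup [set (dotv y u)%:E | u in T].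

Definition error_norm nu L (Rl : 'I_L -> 'M[R]_nu) (u : 'cV[R]_nu) : R :=
  \big[Num.max/0]_(l < L) Num.sqrt (quadform (Rl l) u).

End LinearAlgebra.

Section Ellitope.
Context {R : realType}.

Definition ellitope_base K (T : set 'cV[R]_K) : Prop :=
  [/\ T `<=` @nonnegv R K,
      @convex_set R 'cV[R]_K T,
      compact T,
      interior T !=set0
    & forall t t' : 'cV[R]_K, T t -> nonnegv t' -> lev t' t -> T t'].

Definition ellitope n K (T : set 'cV[R]_K) (Tk : 'I_K -> 'M[R]_n) :
    set 'cV[R]_n :=
  [set x | exists2 t, T t & forall k, quadform (Tk k) x <= t k ord0].

End Ellitope.

Section Observations.
Context {R : realType} {d : measure_display} {Omega : measurableType d}.
Variable P : probability Omega R.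

Definition rvec k (X : 'I_k -> {RV P >-> R}) (w : Omega) : 'cV[R]_k :=
  \col_i X i w.

Definition zero_mean k (X : 'I_k -> {RV P >-> R}) : Prop :=
  forall i, ('E_P[X i] = 0)%E.

Definition subgaussian k (sigma : R) (X : 'I_k -> {RV P >-> R}) : Prop :=
  forall t : 'cV[R]_k,
    ('E_P[fun w => expR (dotv t (rvec X w))]
      <= (expR (sigma ^+ 2 / 2 * l2norm t ^+ 2))%:E)%E.

Definition pert_mx m n q (A : 'M[R]_(m, n)) (Aq : 'I_q -> 'M[R]_(m, n))
    (e : 'cV[R]_q) : 'M[R]_(m, n) :=
  A + \sum_(a < q) e a ord0 *: Aq a.

(* With estimate what, the epsilon-risk
     sup_{x in X} inf {rho : Prob{N(B x - what(A[eta] x + xi)) > rho} <= eps}.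
   The probability is the outer probability mu_ext P, so that it makes sense
   for estimates that are not assumed to be Borel; it is P itself on measurable
   events (measurable_mu_extE). *)
Definition risk m n q nu (A : 'M[R]_(m, n)) (Aq : 'I_q -> 'M[R]_(m, n))
    (B : 'M[R]_(nu, n)) (xi : 'I_m -> {RV P >-> R}) (eta : 'I_q -> {RV P >-> R})
    (N : 'cV[R]_nu -> R) (X : set 'cV[R]_n) (eps : R)
    (what : 'cV[R]_m -> 'cV[R]_nu) : \bar R :=
  ereal_sup
    [set ereal_inf
       [set rho%:E | rho in
         [set rho : R |
           (mu_ext P [set w | (rho < N (B *m x -
               what (pert_mx A Aq (rvec eta w) *m x + rvec xi w)))%R]
             <= eps%:E)%E]]
    | x in X].

End Observations.

Section PolyhedralEstimate.
Context {R : realType}.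

Definition chi (delta : R) : R := 2 * Num.sqrt (2 * ln (2 / delta)).

(* The q x n matrix [h^T A_1; ...; h^T A_q]. *)
Definition calA m n q (Aq : 'I_q -> 'M[R]_(m, n)) (h : 'cV[R]_m) :
    'M[R]_(q, n) :=
  \matrix_(a < q) (h^T *m Aq a).

Definition normX2 q n (X : set 'cV[R]_n) (C : 'M[R]_(q, n)) : \bar R :=
  ereal_sup [set (l2norm (C *m x))%:E | x in X].

Definition admissible_cols m n q (sigma : R) (Aq : 'I_q -> 'M[R]_(m, n))
    (X : set 'cV[R]_n) (delta : R) : set 'cV[R]_m :=
  [set h | l2norm h <= (sigma * chi delta)^-1 /\
           (normX2 X (calA Aq h) <= ((chi delta)^-1)%:E)%E].

(* xhat selects, for every observation, a minimizer over X of
   ||H^T (A u - omega)||_infty. *)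
Definition is_polyhedral_estimate m n N (A : 'M[R]_(m, n)) (X : set 'cV[R]_n)
    (H : 'M[R]_(m, N)) (xhat : 'cV[R]_m -> 'cV[R]_n) : Prop :=
  forall omega : 'cV[R]_m, X (xhat omega) /\
    forall u, X u ->
      `|H^T *m (A *m xhat omega - omega)| <= `|H^T *m (A *m u - omega)|.

Definition pplus_feasible m n nu K L M (A : 'M[R]_(m, n)) (B : 'M[R]_(nu, n))
    (Rl : 'I_L -> 'M[R]_nu) (T : set 'cV[R]_K) (Tk : 'I_K -> 'M[R]_n)
    (H : 'I_L -> 'M[R]_(m, M))
    (lam : 'I_L -> R) (mu : 'I_L -> 'cV[R]_K) (ups : 'I_L -> 'cV[R]_M)
    (rho : R) : Prop :=
  forall l : 'I_L,
    [/\ nonnegv (mu l),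
        nonnegv (ups l),
        ((lam l)%:E + support_fun T (mu l) + (\sum_(j < M) ups l j ord0)%:E
           <= rho%:E)%E
      & psdmx (block_mx
          (lam l)%:M                      (2^-1 *: (sqrtmx (Rl l) *m B))
          (2^-1 *: (B^T *m sqrtmx (Rl l)))
          (A^T *m H l *m diag_mx (ups l)^T *m (H l)^T *m A
             + \sum_(k < K) mu l k ord0 *: Tk k))].

Definition pplus m n nu K L M (A : 'M[R]_(m, n)) (B : 'M[R]_(nu, n))
    (Rl : 'I_L -> 'M[R]_nu) (T : set 'cV[R]_K) (Tk : 'I_K -> 'M[R]_n)
    (H : 'I_L -> 'M[R]_(m, M)) : \bar R :=
  (2%:E * ereal_inf [set rho%:E | rho in
     [set rho : R | exists lam mu ups,
        pplus_feasible A B Rl T Tk H lam mu ups rho]])%E.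

End PolyhedralEstimate.

(* Main.v *)
(* Each column h of H is admissible, so h^T xi and h^T (sum_a eta_a A_a) x are
   sub-Gaussian with parameter at most 1/chi(delta), and their sum exceeds 1 in
   absolute value with probability at most delta. By the union bound, outside an
   event of probability eps all entries of H^T (omega - A x) are at most 1; as x
   competes in the minimization defining xhat, z = (x - xhat)/2, which belongs to
   the symmetric convex set X, satisfies |H^T A z| <= 1 entrywise. Testing the
   matrix inequality on the vector (-u, z) with a unit vector u along
   R_l^{1/2} B z then gives |R_l^{1/2} B z| <= rho. *)

Require Import Defs.
From mathcomp Require Import all_boot all_order all_algebra.
From mathcomp Require Import complex ring lra.
From mathcomp Require Import all_classical all_reals all_analysis measurable_realfun.

Set Implicit Arguments.
Unset Strict Implicit.
Unset Printing Implicit Defensive.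

Import Order.TTheory GRing.Theory Num.Theory.
Import numFieldNormedType.Exports.

Local Open Scope classical_set_scope.
Local Open Scope ring_scope.

(** * Euclidean inner products, quadratic forms and the block matrix inequality *)

Section DotProduct.
Context {R : realType}.

Lemma dotvE n (u v : 'cV[R]_n) : dotv u v = \sum_i u i ord0 * v i ord0.
Proof. by rewrite /dotv mxE; apply: eq_bigr => i _; rewrite mxE. Qed.

Lemma dotvC n (u v : 'cV[R]_n) : dotv u v = dotv v u.
Proof. by rewrite !dotvE; apply: eq_bigr => i _; rewrite mulrC. Qed.

Lemma dotvDl n (u v w : 'cV[R]_n) : dotv (u + v) w = dotv u w + dotv v w.
Proof. by rewrite /dotv linearD mulmxDl mxE. Qed.

Lemma dotvZl n a (u v : 'cV[R]_n) : dotv (a *: u) v = a * dotv u v.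
Proof. by rewrite /dotv linearZ/= -scalemxAl mxE. Qed.

Lemma dotvZr n a (u v : 'cV[R]_n) : dotv u (a *: v) = a * dotv u v.
Proof. by rewrite dotvC dotvZl dotvC. Qed.

Lemma dotvDr n (u v w : 'cV[R]_n) : dotv w (u + v) = dotv w u + dotv w v.
Proof. by rewrite dotvC dotvDl !(dotvC w). Qed.

Lemma dotvv_ge0 n (u : 'cV[R]_n) : 0 <= dotv u u.
Proof. by rewrite dotvE; apply: sumr_ge0 => i _; rewrite -expr2 sqr_ge0. Qed.

Lemma dotvv_gt0 n (u : 'cV[R]_n) : u != 0 -> 0 < dotv u u.
Proof.
move=> u0; rewrite lt_neqAle dotvv_ge0 andbT eq_sym dotvE.
rewrite psumr_eq0 => [|i _]; last by rewrite -expr2 sqr_ge0.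
apply: contra u0 => /allP u0; apply/eqP/matrixP => i j; rewrite (ord1 j) mxE.
have := u0 i (mem_index_enum _).
by rewrite /= mulf_eq0 orbb => /eqP.
Qed.

Lemma sqr_l2norm n (u : 'cV[R]_n) : l2norm u ^+ 2 = dotv u u.
Proof. by rewrite sqr_sqrtr// dotvv_ge0. Qed.

Lemma l2normZ n a (u : 'cV[R]_n) : l2norm (a *: u) = `|a| * l2norm u.
Proof.
by rewrite /l2norm dotvZl dotvZr mulrA -expr2 sqrtrM ?sqr_ge0// sqrtr_sqr.
Qed.

Lemma dotv_trmx m n (u : 'cV[R]_m) (Q : 'M[R]_(m, n)) (v : 'cV[R]_n) :
  dotv (Q^T *m u) v = dotv u (Q *m v).
Proof. by rewrite /dotv trmx_mul trmxK mulmxA. Qed.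

Lemma quadform_dotv n (Q : 'M[R]_n) x : quadform Q x = dotv x (Q *m x).
Proof. by rewrite /quadform /dotv mulmxA. Qed.

Lemma quadformD n (Q1 Q2 : 'M[R]_n) x :
  quadform (Q1 + Q2) x = quadform Q1 x + quadform Q2 x.
Proof. by rewrite !quadform_dotv mulmxDl dotvDr. Qed.

Lemma quadformZ n a (Q : 'M[R]_n) x : quadform (a *: Q) x = a * quadform Q x.
Proof. by rewrite !quadform_dotv -scalemxAl dotvZr. Qed.

Lemma quadform_sum n K (Q : 'I_K -> 'M[R]_n) x :
  quadform (\sum_k Q k) x = \sum_k quadform (Q k) x.
Proof.
apply: (big_ind2 (fun Q q => quadform Q x = q)) => //.
  by rewrite quadform_dotv mul0mx /dotv mulmx0 mxE.
by move=> Q1 _ Q2 _ <- <-; rewrite quadformD.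
Qed.

Lemma quadformZv n a (Q : 'M[R]_n) x : quadform Q (a *: x) = a ^+ 2 * quadform Q x.
Proof. by rewrite !quadform_dotv -scalemxAr dotvZl dotvZr mulrA expr2. Qed.

(** Parallelogram identity, with the nonnegative term at [x + y] dropped. *)
Lemma quadform_sub_le n (Q : 'M[R]_n) x y : psdmx Q ->
  quadform Q (x - y) <= 2 * quadform Q x + 2 * quadform Q y.
Proof.
move=> [_ Q0]; have := Q0 (x + y).
rewrite -(scaleN1r y) !quadform_dotv !(mulmxDr, dotvDl, dotvDr).
by rewrite -!scalemxAr !(dotvZl, dotvZr); lra.
Qed.

Lemma quadform_diag M (ups : 'cV[R]_M) (v : 'cV[R]_M) :
  quadform (diag_mx ups^T) v = \sum_j ups j ord0 * v j ord0 ^+ 2.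
Proof.
rewrite quadform_dotv dotvE; apply: eq_bigr => j _.
by rewrite mul_diag_mx !mxE mulrCA expr2.
Qed.

Lemma quadform_congr m n (C : 'M[R]_(m, n)) (Q : 'M[R]_m) x :
  quadform (C^T *m Q *m C) x = quadform Q (C *m x).
Proof. by rewrite /quadform trmx_mul !mulmxA. Qed.

(** In the quadratic form at [(-u, z)] the two halved off-diagonal blocks add up to minus the
    left-hand side. *)
Lemma psd_block_dotv_le n k (lam : R) (C : 'M[R]_(n, k)) (Q : 'M[R]_k) u z :
  psdmx (block_mx lam%:M (2^-1 *: C) (2^-1 *: C^T) Q) ->
  dotv u (C *m z) <= lam * dotv u u + quadform Q z.
Proof.
move=> [_ /(_ (col_mx (- u) z))].
rewrite quadform_dotv mul_block_col /dotv tr_col_mx mul_row_col mxE.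
rewrite -!/(dotv _ _) !dotvDr mul_scalar_mx -!scalemxAl !dotvZr.
rewrite -(scaleN1r u) -!scalemxAr !(dotvZl, dotvZr).
by rewrite -quadform_dotv (dotvC z) dotv_trmx; lra.
Qed.

Lemma psd_block_l2norm_le n k (lam : R) (C : 'M[R]_(n, k)) (Q : 'M[R]_k) z :
  (0 < n)%N -> psdmx (block_mx lam%:M (2^-1 *: C) (2^-1 *: C^T) Q) ->
  l2norm (C *m z) <= lam + quadform Q z.
Proof.
move=> n0 psd; have [Cz0|Cz0] := eqVneq (C *m z) 0.
  (* There is no direction to normalize here. Any unit vector shows that the right-hand side is
     nonnegative, and [0 < n] supplies a basis vector. *)
  have := psd_block_dotv_le (delta_mx (Ordinal n0) ord0) z psd.
  rewrite Cz0 /l2norm /dotv !mulmx0 mxE sqrtr0 trmx_delta mul_delta_mx.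
  by rewrite mxE !eqxx mulr1.
have w0 := dotvv_gt0 Cz0; have s0 : 0 < l2norm (C *m z) by rewrite sqrtr_gt0.
have := psd_block_dotv_le ((l2norm (C *m z))^-1 *: (C *m z)) z psd.
rewrite !(dotvZl, dotvZr) -sqr_l2norm expr2 mulKf ?gt_eqF//.
by rewrite mulVf ?gt_eqF// mulr1.
Qed.

End DotProduct.

(** * Existence of the positive semidefinite square root *)

Section SquareRoot.

Lemma horner_interpolation (F : fieldType) (s : seq F) (f : F -> F) :
  exists p : {poly F}, {in s, forall x, p.[x] = f x}.
Proof.
elim: s => [|a s [p ps]]; first by exists 0.
have [as_|as_] := boolP (a \in s).
  by exists p => x; rewrite inE => /predU1P[->|]; apply: ps.
(* Newton's correction: adding a multiple of [w] keeps the values on [s] and adjusts the value at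
   [a]. *)
pose w := \prod_(b <- s) ('X - b%:P).
have wa : w.[a] != 0.
  by rewrite -[_ == 0]/(root w a) root_prod_XsubC.
exists (p + ((f a - p.[a]) / w.[a])%:P * w) => x.
rewrite !hornerE inE => /predU1P[->|xs]; first by rewrite divfK// addrC subrK.
have /eqP -> : w.[x] == 0 by rewrite -[_ == 0]/(root w x) root_prod_XsubC.
by rewrite mulr0 addr0 ps.
Qed.

Lemma psdmx_eigenvalue_ge0 {R : realType} n (Q : 'M[R]_n) a :
  psdmx Q -> eigenvalue Q a -> 0 <= a.
Proof.
move=> [Qt Q0] /eigenvalueP[v vQ v0].
have := Q0 v^T; rewrite /quadform trmxK vQ -scalemxAl mxE.
rewrite -[(v *m _) _ _]/((v *m v^T) ord0 ord0) -{1}[v]trmxK -/(dotv _ _).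
by rewrite pmulr_lge0// dotvv_gt0// trmx_eq0.
Qed.

Lemma trmx_horner (R : comNzRingType) n (Q : 'M[R]_n.+1) p :
  (horner_mx Q p)^T = horner_mx Q^T p.
Proof.
elim/poly_ind: p => [|p c IH]; first by rewrite !rmorph0 trmx0.
rewrite !(rmorphD, rmorphM)/= !(horner_mx_X, horner_mx_C) linearD/=.
rewrite tr_scalar_mx; congr (_ + _).
(* Transposition reverses the product; the factors commute, both being polynomials in [Q^T]. *)
rewrite -[_ * Q]/(_ *m Q) trmx_mul IH.
by apply: comm_mx_horner.
Qed.

Lemma horner_mx_diagonalized (F : fieldType) n (Q P : 'M[F]_n.+1) d p :
  P \is a GRing.unit -> Q = invmx P *m diag_mx d *m P ->
  horner_mx Q p = invmx P *m diag_mx (map_mx (horner p) d) *m P.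
Proof. by move=> Pu ->; rewrite horner_mx_uconjC// horner_mx_diag. Qed.

Lemma psdmx_sqr {R : realType} n (Q : 'M[R]_n) : Q^T = Q -> psdmx (Q *m Q).
Proof.
move=> Qt; split; first by rewrite trmx_mul Qt.
by move=> x; rewrite quadform_dotv -mulmxA -{1}Qt -dotv_trmx trmxK dotvv_ge0.
Qed.

(* The root is S^2 with S = p(Q), p interpolating the fourth root on the spectrum
   of Q. Being a real polynomial in Q, S is real although the diagonalization of Q
   is complex, and S^2 is positive semidefinite because S is symmetric. *)
Lemma psdmx_sqrt_exists {R : realType} n (Q : 'M[R]_n) : psdmx Q ->
  exists S : 'M[R]_n, psdmx S /\ S *m S = Q.
Proof.
case: n Q => [|n] Q psdQ.
  by exists Q; split => //; apply/matrixP => -[].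
have [Qt _] := psdQ.
pose toC : {rmorphism R -> R[i]} := real_complex R.
pose QC : 'M[R[i]]_n.+1 := map_mx toC Q.
have QCh : QC \is hermsymmx.
  apply: realsym_hermsym.
    apply/is_hermitianmxP; rewrite expr0 scale1r.
    by rewrite map_mx_id// /QC map_trmx Qt.
  by apply/mxOverP => i j; rewrite mxE; apply/complex_realP; exists (Q i j).
have QCE := orthomx_spectralP (hermitian_normalmx QCh).
have /mxOverP sp_real := hermitian_spectral_diag_real QCh.
set P := spectralmx QC in QCE; set sp := spectral_diag QC in QCE sp_real.
have Pu : P \is a GRing.unit by exact: spectral_unit.
pose D : 'rV[R]_n.+1 := map_mx (@complex.Re R) sp.
have spD : sp = map_mx toC D.
  by apply/matrixP => i j; rewrite !mxE; apply/esym/RRe_real/sp_real.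
clearbody D.
(* The entries of [D] are eigenvalues of [QC], with the rows of [P] as left eigenvectors. They pass
   down to [Q] as real roots of the characteristic polynomial. *)
have D_ge0 j : 0 <= D ord0 j.
  apply: (psdmx_eigenvalue_ge0 psdQ).
  rewrite eigenvalue_root_char -(fmorph_root toC) map_char_poly -/QC.
  rewrite -eigenvalue_root_char.
  apply/eigenvalueP; exists (row j P).
    rewrite -row_mul {1}QCE !mulmxA mulmxV// mul1mx.
    rewrite row_mul row_diag_mx -scalemxAl rowE; congr (_ *: _).
    by rewrite spD mxE.
  (* A zero row would make [P] singular. *)
  apply: contraTneq Pu => Pj0; rewrite unitmxE.
  suff -> : \det P = 0 by rewrite unitr0.
  rewrite (expand_det_row P j) big1// => k _.
  by move/rowP/(_ k): Pj0; rewrite !mxE => ->; rewrite mul0r.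
have [p pE] := horner_interpolation [seq D ord0 j | j : 'I_n.+1]
  (fun a => Num.sqrt (Num.sqrt a)).
pose S := horner_mx Q p.
have St : S^T = S by rewrite trmx_horner Qt.
exists (S *m S); split; first exact: psdmx_sqr.
(* The embedding of the reals is injective, so equality can be checked after complexification, where
   it reduces to the diagonal entries. *)
suff : map_mx toC (horner_mx Q (p ^+ 4)) = QC.
  move=> /map_mx_inj <-.
  by rewrite rmorphXn/= -/S !exprS expr0 mulr1 -!mulmxE !mulmxA.
rewrite [LHS](map_horner_mx toC Q) -[map_mx toC Q]/QC.
rewrite [LHS](horner_mx_diagonalized _ Pu QCE).
apply: etrans (esym QCE).
congr (_ *m diag_mx _ *m _); apply/rowP => j.
rewrite spD !mxE horner_map horner_exp; congr (toC _).
rewrite pE.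
  by rewrite (exprM _ 2 2) sqr_sqrtr ?sqrtr_ge0// sqr_sqrtr.
by rewrite map_f// mem_enum.
Qed.

End SquareRoot.

(** * Half-differences of points of an ellitope *)

Section Ellitopes.
Context {R : realType}.

Lemma convex_set_midpoint n (T : set 'cV[R]_n) t s :
  @convex_set R 'cV[R]_n T -> T t -> T s -> T (2^-1 *: (t + s)).
Proof.
move=> cT Tt Ts.
have h0 : 0 <= (2^-1 : R) by lra.
have h1 : (2^-1 : R) <= 1 by lra.
have := cT t s (Itv01 h0 h1) (mem_set Tt) (mem_set Ts).
rewrite inE; congr (T _); rewrite /conv/= scalerDr.
by congr (_ + _ *: _); rewrite /unstable.onem; lra.
Qed.

(** The factor 1/4 from halving turns the bound [2 t + 2 s] into the midpoint of [t] and [s], which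
    lies in [T] by convexity. *)
Lemma ellitope_half_sub n K (T : set 'cV[R]_K) (Tk : 'I_K -> 'M[R]_n) x y :
  @convex_set R 'cV[R]_K T -> (forall k, psdmx (Tk k)) ->
  ellitope T Tk x -> ellitope T Tk y -> ellitope T Tk (2^-1 *: (x - y)).
Proof.
move=> cT psdT [t Tt xt] [s Ts ys].
exists (2^-1 *: (t + s)); first exact: convex_set_midpoint.
move=> k; rewrite quadformZv !mxE.
have := quadform_sub_le x y (psdT k); have := xt k; have := ys k.
by rewrite expr2; lra.
Qed.

End Ellitopes.

(** * Sub-Gaussian tails and the union bound *)

Section Tails.
Context {R : realType} {d : measure_display} {Omega : measurableType d}
  (P : probability Omega R).

Lemma measurable_dotv_rvec k (h : 'cV[R]_k) (X : 'I_k -> {RV P >-> R}) :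
  measurable_fun setT (fun w => dotv h (rvec X w)).
Proof.
under eq_fun do rewrite dotvE.
apply: measurable_sum => i; under eq_fun do rewrite mxE.
exact: measurable_funM.
Qed.

(** Here [c] is the inverse of the sub-Gaussian parameter, matching the bounds by 1/chi in the
    admissible set. *)
Definition mgf_bounded (c : R) (Z : Omega -> R) :=
  forall t : R, ('E_P[fun w => expR (t * Z w)] <=
    (expR (t ^+ 2 / (2 * c ^+ 2)))%:E)%E.

(* No independence: convexity of exp replaces it, at the price of doubling the
   sub-Gaussian parameter. *)
Lemma mgf_boundedD_tail (c : R) (Y Z : Omega -> R) : 0 < c ->
  measurable_fun setT Y -> measurable_fun setT Z ->
  mgf_bounded c Y -> mgf_bounded c Z ->
  (P [set w | (1 <= Y w + Z w)%R] <= (expR (- (c ^+ 2 / 8)))%:E)%E.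
Proof.
move=> c0 mY mZ bY bZ.
have mYZ : measurable_fun setT (fun w => Y w + Z w) by exact: measurable_funD.
pose YZ : {RV P >-> R} := mfun_Sub (mem_set mYZ).
(* This [r] minimizes the Chernoff exponent [2 r^2 / c^2 - r], with minimum [- c^2 / 8]. *)
have r0 : 0 < c ^+ 2 / 4 by rewrite divr_gt0 ?exprn_gt0.
have := chernoff YZ 1 r0; rewrite mulr1 => /le_trans; apply.
have -> : expR (- (c ^+ 2 / 8)) = expR (c ^+ 2 / 8) * expR (- (c ^+ 2 / 4)).
  by rewrite -expRD; congr expR; lra.
rewrite EFinM lee_wpmul2r ?lee_fin ?expR_ge0//.
have mexp (V : Omega -> R) : measurable_fun setT V ->
    measurable_fun setT (fun w => (2^-1 * expR (c ^+ 2 / 2 * V w))%:E).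
  move=> mV; apply/measurable_EFinP; apply: measurable_funM => //.
  by apply: measurableT_comp => //; exact: measurable_funM.
rewrite /mmt_gen_fun unlock.
have half_le (V : Omega -> R) : measurable_fun setT V -> mgf_bounded c V ->
    (\int[P]_w (2^-1 * expR (c ^+ 2 / 2 * V w))%:E <=
      (2^-1 * expR (c ^+ 2 / 8))%:E)%E.
  move=> mV /(_ (c ^+ 2 / 2)); rewrite unlock => bV.
  under eq_integral do rewrite EFinM.
  rewrite ge0_integralZl//; last first.
    apply/measurable_EFinP.
    by apply: measurableT_comp => //; exact: measurable_funM.
  rewrite EFinM lee_wpmul2l ?lee_fin ?invr_ge0//.
  apply: le_trans bV _; rewrite lee_fin ler_expR le_eqVlt; apply/orP; left.
  by apply/eqP; field; rewrite gt_eqF.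
apply: (@le_trans _ _ (\int[P]_w ((2^-1 * expR (c ^+ 2 / 2 * Y w))%:E +
    (2^-1 * expR (c ^+ 2 / 2 * Z w))%:E))%E).
  apply: ge0_le_integral => //.
  - by move=> w _; rewrite lee_fin expR_ge0.
  - apply/measurable_EFinP; apply: measurableT_comp => //=.
    exact: measurable_funM.
  - by apply: emeasurable_funD; exact: mexp.
  move=> w _; rewrite -EFinD lee_fin /=.
  (* Convexity enters as [a b <= (a^2 + b^2) / 2]; squaring doubles the exponent to [c^2 / 2]. *)
  set a := expR (c ^+ 2 / 4 * Y w); set b := expR (c ^+ 2 / 4 * Z w).
  have sq (v : R) : expR (c ^+ 2 / 2 * v) = expR (c ^+ 2 / 4 * v) ^+ 2.
    by rewrite -expRM_natr; congr expR; lra.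
  rewrite !sq -/a -/b.
  have -> : expR ((Y w + Z w) * (c ^+ 2 / 4)) = a * b.
    by rewrite /a /b -expRD; congr expR; lra.
  by have := sqr_ge0 (a - b); rewrite sqrrB; lra.
rewrite ge0_integralD//; [|exact: mexp|exact: mexp].
apply: le_trans (leeD (half_le Y mY bY) (half_le Z mZ bZ)) _.
by rewrite -EFinD lee_fin; lra.
Qed.

Lemma mgf_boundedN c Z : mgf_bounded c Z -> mgf_bounded c (fun w => - Z w).
Proof.
move=> bZ t; have := bZ (- t); rewrite sqrrN.
by under [X in ('E_P[X] <= _)%E]eq_fun do rewrite mulNr -mulrN.
Qed.

Lemma mgf_boundedD_abs_tail (c : R) (Y Z : Omega -> R) : 0 < c ->
  measurable_fun setT Y -> measurable_fun setT Z ->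
  mgf_bounded c Y -> mgf_bounded c Z ->
  (P [set w | (1 <= `|Y w + Z w|)%R] <= (2 * expR (- (c ^+ 2 / 8)))%:E)%E.
Proof.
move=> c0 mY mZ bY bZ.
have mN (V : Omega -> R) : measurable_fun setT V ->
    measurable_fun setT (fun w => - V w).
  by move=> mV; exact: measurableT_comp.
have mge (V W : Omega -> R) : measurable_fun setT V -> measurable_fun setT W ->
    measurable [set w | 1 <= V w + W w].
  move=> mV mW; have := measurable_funD mV mW => mVW.
  rewrite -[X in measurable X]setTI.
  exact: (measurable_fun_le measurableT (@measurable_cst _ _ _ _ _ (1 : R)) mVW).
have t1 := mgf_boundedD_tail c0 mY mZ bY bZ.
have t2 := mgf_boundedD_tail c0 (mN _ mY) (mN _ mZ)
  (mgf_boundedN bY) (mgf_boundedN bZ).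
have -> : [set w | (1 <= `|Y w + Z w|)%R] =
    [set w | (1 <= Y w + Z w)%R] `|` [set w | (1 <= - Y w + - Z w)%R].
  by apply/seteqP; split=> w /=; rewrite ler_normr -opprD => /orP.
apply: (le_trans (measureU2 _ _ _)); [by apply: mge|by apply: mge; exact: mN|].
apply: le_trans (leeD t1 t2) _.
by rewrite -EFinD lee_fin; lra.
Qed.

(** Sub-Gaussianity at the vector [t *: h] gives the exponent [s^2 t^2 |h|^2 / 2], and the bound on
    [|h|] turns it into [t^2 / (2 c^2)]. *)
Lemma subgaussian_mgf_bounded k (s c : R) (X : 'I_k -> {RV P >-> R}) (h : 'cV[R]_k) :
  0 < s -> 0 < c -> subgaussian s X -> l2norm h <= (s * c)^-1 ->
  mgf_bounded c (fun w => dotv h (rvec X w)).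
Proof.
move=> s0 c0 sX hle t; have := sX (t *: h).
under [X in ('E_P[X] <= _)%E]eq_fun do rewrite dotvZl.
move=> /le_trans; apply; rewrite lee_fin ler_expR l2normZ exprMn.
rewrite real_normK ?num_real//.
rewrite mulrCA ler_wpM2l ?sqr_ge0//.
have -> : (2 * c ^+ 2)^-1 = s ^+ 2 / 2 * (s * c)^-1 ^+ 2.
  by field; rewrite !gt_eqF.
apply: ler_wpM2l; first by rewrite divr_ge0 ?sqr_ge0.
by rewrite lerXn2r ?nnegrE ?sqrtr_ge0// invr_ge0 mulr_ge0// ltW.
Qed.

Lemma measure_bigcup_ord_le N (e : R) (E : 'I_N -> set Omega) :
  (forall j, measurable (E j)) -> (forall j, (P (E j) <= e%:E)%E) ->
  (P (\big[setU/set0]_(j < N) E j) <= (N%:R * e)%:E)%E.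
Proof.
elim: N E => [|N IH] E mE PE; first by rewrite big_ord0 measure0 mul0r.
rewrite big_ord_recl.
apply: (le_trans (measureU2 _ _ _)) => //.
  by apply: bigsetU_measurable.
rewrite -nat1r mulrDl mul1r EFinD; apply: leeD; [exact: PE|exact: IH].
Qed.

End Tails.

(** * Calibration of the threshold chi *)

Section Chi.
Context {R : realType}.

Lemma chi_gt0 (e : R) : 0 < e < 1 -> 0 < chi e.
Proof.
move=> /andP[e0 e1]; rewrite mulr_gt0// sqrtr_gt0 mulr_gt0// ln_gt0//.
by rewrite ltr_pdivlMr//; lra.
Qed.

(** The constants in [chi] are such that [chi e ^+ 2 / 8 = ln (2 / e)], so the two-sided tail bound
    is exactly [e]. *)
Lemma chi_tail (e : R) : 0 < e < 1 -> 2 * expR (- (chi e ^+ 2 / 8)) = e.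
Proof.
move=> /andP[e0 e1]; have l0 : 0 < ln (2 / e).
  by rewrite ln_gt0// ltr_pdivlMr//; lra.
have -> : chi e ^+ 2 / 8 = ln (2 / e).
  by rewrite /chi exprMn sqr_sqrtr ?mulr_ge0 ?(ltW l0)//; field.
rewrite expRN lnK ?posrE ?divr_gt0// invf_div mulrC divfK//.
Qed.

End Chi.

(** * Deterministic bounds: feasible points and residuals *)

Section Polyhedral.
Context {R : realType}.

(** Existence of a root guarantees that the choice [xget] returns a genuine root. *)
Lemma sqrtmxP n (Q : 'M[R]_n) : psdmx Q ->
  psdmx (sqrtmx Q) /\ sqrtmx Q *m sqrtmx Q = Q.
Proof.
move=> /psdmx_sqrt_exists sqrtQ.
exact: (@xgetPex _ 0 [set S : 'M[R]_n | psdmx S /\ S *m S = Q] sqrtQ).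
Qed.

Lemma sqrt_quadform_l2norm n (Q : 'M[R]_n) u : psdmx Q ->
  Num.sqrt (quadform Q u) = l2norm (sqrtmx Q *m u).
Proof.
move=> /sqrtmxP[[St _] SS].
by rewrite /l2norm -dotv_trmx St mulmxA SS quadform_dotv dotvC.
Qed.

Lemma dotv_col m N (G : 'M[R]_(m, N)) v j : dotv (col j G) v = (G^T *m v) j ord0.
Proof. by rewrite /dotv tr_col -row_mul [LHS]mxE. Qed.

(** The block inequality bounds the norm by [lam l] plus a quadratic form in [z]. Its [mu] part is
    at most the support function, since the parameter [t] of [z] lies in [T]; its [ups] part is at
    most the sum of the [ups l j], since the entries of [H^T A z] are at most 1 in absolute
    value. *)
Lemma pplus_feasible_bound m n nu K L M (A : 'M[R]_(m, n)) (B : 'M[R]_(nu, n))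
    (Rl : 'I_L -> 'M[R]_nu) (T : set 'cV[R]_K) (Tk : 'I_K -> 'M[R]_n)
    (H : 'I_L -> 'M[R]_(m, M)) lam mu ups rho z l :
  (0 < nu)%N -> (forall l, psdmx (Rl l)) ->
  pplus_feasible A B Rl T Tk H lam mu ups rho ->
  ellitope T Tk z -> (forall j, `|dotv (col j (H l)) (A *m z)| <= 1) ->
  Num.sqrt (quadform (Rl l) (B *m z)) <= rho.
Proof.
move=> nu0 psdR /(_ l)[mu0 ups0 lerho psdblk] [t Tt zt] Hz.
rewrite sqrt_quadform_l2norm// mulmxA.
have [[St _] _] := sqrtmxP (psdR l).
have CT : B^T *m sqrtmx (Rl l) = (sqrtmx (Rl l) *m B)^T by rewrite trmx_mul St.
rewrite CT in psdblk; apply: le_trans (psd_block_l2norm_le z nu0 psdblk) _.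
have : ((lam l + dotv (mu l) t + \sum_(j < M) ups l j ord0)%:E <= rho%:E)%E.
  apply: le_trans lerho; rewrite !EFinD leeD2r// leeD2l//.
  by apply: ereal_sup_ubound; exists t.
rewrite lee_fin; apply: le_trans.
rewrite -addrA lerD2l [leRHS]addrC quadformD lerD//; last first.
  rewrite quadform_sum dotvE; apply: ler_sum => k _.
  by rewrite quadformZ ler_wpM2l.
have -> : A^T *m H l *m diag_mx (ups l)^T *m (H l)^T *m A =
    ((H l)^T *m A)^T *m diag_mx (ups l)^T *m ((H l)^T *m A).
  by rewrite trmx_mul trmxK !mulmxA.
rewrite quadform_congr quadform_diag; apply: ler_sum => j _.
rewrite -[leRHS]mulr1 ler_wpM2l// -mulmxA -dotv_col.
by rewrite -real_normK ?num_real// exprn_ile1.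
Qed.

Lemma error_norm_le nu L (Rl : 'I_L -> 'M[R]_nu) u r :
  0 <= r -> (forall l, Num.sqrt (quadform (Rl l) u) <= r) -> error_norm Rl u <= r.
Proof. by move=> r0 Hr; apply: bigmax_le => // l _; exact: Hr. Qed.

Lemma normr_dotv_col_le m N (G : 'M[R]_(m, N)) (v : 'cV[R]_m) j :
  `|dotv (col j G) v| <= `|G^T *m v|.
Proof.
rewrite dotv_col /Num.norm/= mx_normrE.
exact: (le_bigmax _ (fun ij => `|(G^T *m v) ij.1 ij.2|) (j, ord0)).
Qed.

Lemma normr_trmx_mul_le m N (G : 'M[R]_(m, N)) (v : 'cV[R]_m) r : 0 <= r ->
  (forall j, `|dotv (col j G) v| <= r) -> `|G^T *m v| <= r.
Proof.
move=> r0 Hr; rewrite /Num.norm/= mx_normrE; apply: bigmax_le => // -[j i] _ /=.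
by rewrite (ord1 i) -dotv_col.
Qed.

(** The residual of [x] has norm at most 1, hence so has that of the minimizer; their difference has
    norm at most 2, and halving restores 1. *)
Lemma polyhedral_estimate_residual m n N (A : 'M[R]_(m, n)) X
    (G : 'M[R]_(m, N)) xhat x omega :
  is_polyhedral_estimate A X G xhat -> X x ->
  (forall j, `|dotv (col j G) (omega - A *m x)| <= 1) ->
  forall j, `|dotv (col j G) (A *m (2^-1 *: (x - xhat omega)))| <= 1.
Proof.
move=> /(_ omega)[_ /(_ x)] hmin Xx small j.
have r1 : `|G^T *m (A *m x - omega)| <= 1.
  by rewrite -opprB mulmxN normrN; apply: normr_trmx_mul_le.
have r2 := le_trans (hmin Xx) r1.
apply: le_trans (normr_dotv_col_le _ _ _) _.
rewrite -scalemxAr -scalemxAr normrZ ger0_norm ?invr_ge0// ler_pdivrMl// mulr1.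
have -> : G^T *m (A *m (x - xhat omega)) =
    G^T *m (A *m x - omega) - G^T *m (A *m xhat omega - omega).
  by rewrite -mulmxBr opprB addrA subrK -mulmxBr.
by apply: le_trans (ler_normB _ _) _; lra.
Qed.

End Polyhedral.

(** * Tail of a single residual, then the risk bound *)

Lemma admissible_cols_tail (R : realType) (d : measure_display)
    (Omega : measurableType d) (P : probability Omega R) m n q
    (A : 'M[R]_(m, n)) (Aq : 'I_q -> 'M[R]_(m, n)) (sigma delta : R)
    (xi : 'I_m -> {RV P >-> R}) (eta : 'I_q -> {RV P >-> R}) X h x :
  0 < sigma -> subgaussian sigma xi -> subgaussian 1 eta -> 0 < delta < 1 ->
  admissible_cols sigma Aq X delta h -> X x ->
  let E := [set w |
    1 <= `|dotv h (pert_mx A Aq (rvec eta w) *m x + rvec xi w - A *m x)|] in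
  measurable E /\ (P E <= delta%:E)%E.
Proof.
move=> sigma0 sxi seta delta01 [hle nX] Xx E.
(* The residual along [h] is [h^T xi + g^T eta]; the two admissibility conditions bound [|h|] and
   [|g|] respectively. *)
pose g := calA Aq h *m x.
have resE w : dotv h (pert_mx A Aq (rvec eta w) *m x + rvec xi w - A *m x) =
    dotv h (rvec xi w) + dotv g (rvec eta w).
  rewrite /pert_mx mulmxDl addrAC [A *m x + _]addrC addrK dotvDr addrC.
  congr (_ + _); rewrite mulmx_suml [RHS]dotvE /dotv mulmx_sumr summxE.
  apply: eq_bigr => a _; rewrite -scalemxAl -scalemxAr mxE mulrC.
  congr (_ * _); rewrite mulmxA /g /calA !mxE.
  by apply: eq_bigr => j _; rewrite !mxE.
have chi0 := chi_gt0 delta01.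
have bxi := subgaussian_mgf_bounded sigma0 chi0 sxi hle.
have gle : l2norm g <= (1 * chi delta)^-1.
  rewrite mul1r -lee_fin; apply: le_trans nX.
  by apply: ereal_sup_ubound; exists x.
have beta := subgaussian_mgf_bounded ltr01 chi0 seta gle.
have mxi := measurable_dotv_rvec h xi.
have meta := measurable_dotv_rvec g eta.
have -> : E = [set w | (1 <= `|dotv h (rvec xi w) + dotv g (rvec eta w)|)%R].
  by apply/seteqP; split=> w; rewrite /E /= resE.
split.
  rewrite -[X in measurable X]setTI.
  apply: (measurable_fun_le measurableT (@measurable_cst _ _ _ _ _ (1 : R))).
  by apply: measurableT_comp => //; exact: measurable_funD.
rewrite -[in leRHS](chi_tail delta01).
exact: mgf_boundedD_abs_tail.
Qed.

Theorem proposition2p3 (R : realType) (d : measure_display)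
    (Omega : measurableType d) (P : probability Omega R)
    (m n nu q K L M : nat)
    (A : 'M[R]_(m, n)) (Aq : 'I_q -> 'M[R]_(m, n)) (B : 'M[R]_(nu, n))
    (sigma : R) (xi : 'I_m -> {RV P >-> R}) (eta : 'I_q -> {RV P >-> R})
    (Rl : 'I_L -> 'M[R]_nu) (T : set 'cV[R]_K) (Tk : 'I_K -> 'M[R]_n)
    (eps : R) (H : 'I_L -> 'M[R]_(m, M)) (xhat : 'cV[R]_m -> 'cV[R]_n)
    (X := ellitope T Tk) (Hmx := \mxrow_(l < L) H l)
    (delta := eps / (M * L)%:R) :
  (0 < nu)%N -> (0 < M)%N ->
  0 < sigma ->
  zero_mean xi -> subgaussian sigma xi ->
  zero_mean eta -> subgaussian 1 eta ->
  (forall l, psdmx (Rl l)) -> pdmx (\sum_(l < L) Rl l) ->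
  (forall k, psdmx (Tk k)) -> pdmx (\sum_(k < K) Tk k) ->
  ellitope_base T ->
  0 < eps < 1 ->
  (forall j, admissible_cols sigma Aq X delta (col j Hmx)) ->
  is_polyhedral_estimate A X Hmx xhat ->
  (risk A Aq B xi eta (error_norm Rl) X eps (fun omega => B *m xhat omega)
    <= pplus A B Rl T Tk H)%E.

Proof.
move=> nu0 M0 sigma0 _ sxi _ seta psdR pdR psdT _ [_ convT _ _ _] /andP[eps0 eps1].
move=> Hadm Hxhat.
(* For [L = 0] the sum of the [Rl l] would be zero, which is not positive definite in positive
   dimension. *)
have L0 : (0 < L)%N.
  rewrite lt0n; apply: contraTneq nu0 => L0; move: pdR => [_ pdR].
  rewrite -leqNgt leqn0; apply/eqP; case: nu B Rl psdR pdR => // nu' B' R' _ pdR.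
  have /pdR : (const_mx 1 : 'cV[R]_nu'.+1) != 0.
    apply/eqP => /matrixP/(_ ord0 ord0); rewrite !mxE => /eqP.
    by rewrite oner_eq0.
  by rewrite quadform_sum big1 ?ltxx// => -[i iL]; exfalso; rewrite L0 in iL.
have ML0 : 0 < (M * L)%:R :> R by rewrite ltr0n muln_gt0 M0.
have delta01 : 0 < delta < 1.
  rewrite divr_gt0//= ltr_pdivrMr// mul1r (lt_le_trans eps1)// ler1n.
  by rewrite muln_gt0 M0.
rewrite /pplus -ereal_inf_pZl//.
apply: le_ereal_inf_tmp => _ [_ [rho [lam [mu [ups feas]]] <-] <-].
apply: ge_ereal_sup => _ [x Xx <-].
(* The level is [2 * rho] because the error is twice [B *m z], with [z] the half-difference. *)
apply: ereal_inf_lbound; exists (2 * rho); last by rewrite EFinM.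
pose E j := [set w | 1 <= `|dotv (col j Hmx)
  (pert_mx A Aq (rvec eta w) *m x + rvec xi w - A *m x)|].
have tailE j := admissible_cols_tail A sigma0 sxi seta delta01 (Hadm j) Xx.
(* The error event need not be measurable; it is covered by the union of the [E j], which is, so the
   outer probability of the cover is [P]. *)
apply: (@le_trans _ _ (mu_ext P (\big[setU/set0]_j E j))).
  apply: le_mu_ext => w /=; apply: contraPP => nE; apply/negP; rewrite -leNgt.
  set omega := pert_mx _ _ _ *m x + _.
  have small j : `|dotv (col j Hmx) (omega - A *m x)| <= 1.
    rewrite leNgt; apply/negP => /ltW Ej; apply: nE.
    by rewrite -bigcup_seq; exists j => //=; exact: mem_index_enum.
  have := polyhedral_estimate_residual Hxhat Xx small.
  set z := 2^-1 *: (x - xhat omega) => zsmall.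
  have Xz : X z.
    by apply: ellitope_half_sub => //; have [] := Hxhat omega.
  have zl l : Num.sqrt (quadform (Rl l) (B *m z)) <= rho.
    apply: (pplus_feasible_bound nu0 psdR feas Xz) => j.
    (* [tagnat.Rank] gives the position of column [j] of block [l] in the concatenation. *)
    suff -> : col j (H l) = col (tagnat.Rank (p_ := fun=> M) l j) Hmx by [].
    by rewrite -[H l](mxrowK H); apply/colP => i; rewrite !mxE.
  (* The maximum in [error_norm] starts from 0, so its bound must be nonnegative; any one block
     shows this. *)
  have rho0 : 0 <= rho.
    by apply: le_trans (zl (Ordinal L0)); rewrite sqrtr_ge0.
  apply: error_norm_le => [|l]; first by rewrite mulr_ge0.
  rewrite -mulmxBr.
  have -> : B *m (x - xhat omega) = 2 *: (B *m z).
    by rewrite /z -scalemxAr scalerA divff ?scale1r.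
  rewrite quadformZv sqrtrM ?sqr_ge0// sqrtr_sqr ger0_norm//.
  by rewrite ler_wpM2l.
rewrite measurable_mu_extE; last first.
  by apply: bigsetU_measurable => j _; have [] := tailE j.
apply: le_trans (measure_bigcup_ord_le (e := delta) _ _) _ => [j|j|].
- by have [] := tailE j.
- by have [] := tailE j.
(* There are [M * L] columns, each contributing [delta = eps / (M * L)]. *)
rewrite sum_nat_const card_ord mulnC /delta lee_fin mulrC divfK//.
by rewrite gt_eqF.
Qed.
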